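(* Let $q\in\mathbb{N}$ and let $(\vec{H},h)$ be a $q$-coloured MINI-orientation of a graph $H$. Let $\vec{G}$ be an orientation of a graph $G$ and let $\psi$ be an out-neighbourhood injective homomorphism from $\vec{G}$ to $\vec{H}$. Then $(\vec{G},h\circ\psi)$ is a $q$-coloured MINI-orientation of $G$.
   Context: Graphs are finite and simple. A $q$-colouring of $G$ assigns colours from $\mathbb{Z}_q$ with adjacent vertices coloured differently. For an orientation $\vec{G}$ and a $q$-colouring $f$, $(\vec{G},f)$ is a $q$-coloured MINI-orientation if for every vertex $v$: (i) no out-neighbour of $v$ has the same colour as an in-neighbour of $v$; (ii) the out-neighbours of $v$ have pairwise distinct colours; (iii) all in-neighbours of $v$ have the same colour. A homomorphism of oriented graphs $\psi\colon V(\vec{G})\to V(\vec{H})$ maps arcs to arcs; it is out-neighbourhood injective if for every vertex $v$ its restriction to $N^+_{\vec{G}}(v)$ is injective (into $N^+_{\vec{H}}(\psi(v))$). *)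

(* Defs.v *)
From mathcomp Require Import all_boot.
Set Implicit Arguments.
Unset Strict Implicit.
Unset Printing Implicit Defensive.

Record sgraph := SGraph {
  vertex :> finType;
  adj : rel vertex;
  adj_sym : symmetric adj;
  adj_irr : irreflexive adj
}.

Definition orientation_of (G : sgraph) (arc : rel G) : Prop :=
  (forall u v : G, arc u v -> adj u v) /\
  (forall u v : G, adj u v -> arc u v (+) arc v u).

Definition out_nbhd (T : finType) (arc : rel T) (v : T) : {set T} :=
  [set w | arc v w].

Definition in_nbhd (T : finType) (arc : rel T) (v : T) : {set T} :=
  [set u | arc u v].

(* The colour set Z_q is used only as a set of q colours. It is 'I_q rather
   than 'Z_q, which has two elements when q < 2. *)
Definition colouring (G : sgraph) (q : nat) (f : G -> 'I_q) : Prop :=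
  forall u v : G, adj u v -> f u <> f v.

Definition coloured_MINI_orientation
    (G : sgraph) (q : nat) (arc : rel G) (f : G -> 'I_q) : Prop :=
  [/\ orientation_of arc,
      colouring f
    & forall v : G,
      [/\ {in out_nbhd arc v & in_nbhd arc v, forall u w, f u <> f w},
          {in out_nbhd arc v &, injective f}
        & {in in_nbhd arc v &, forall u w, f u = f w}]].

Definition oriented_hom (T U : finType) (arcT : rel T) (arcU : rel U)
    (psi : T -> U) : Prop :=
  forall u v : T, arcT u v -> arcU (psi u) (psi v).

Definition out_nbhd_injective (T U : finType) (arcT : rel T)
    (psi : T -> U) : Prop :=
  forall v : T, {in out_nbhd arcT v &, injective psi}.

(* Main.v *)
Require Import Defs.
From mathcomp Require Import all_boot.

(** Every local condition at [v] is pulled back from the one at [psi v], because a homomorphism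
    sends out-neighbours of [v] to out-neighbours of [psi v], and in-neighbours to in-neighbours.
    Only distinctness of out-neighbour colours needs more: [psi] must not merge out-neighbours,
    which is [hinj]. *)

Theorem theorem5 (q : nat)
    (H : sgraph) (arcH : rel H) (h : H -> 'I_q)
    (hMINI : coloured_MINI_orientation arcH h)
    (G : sgraph) (arcG : rel G) (hG : orientation_of arcG)
    (psi : G -> H)
    (hhom : oriented_hom arcG arcH psi)
    (hinj : out_nbhd_injective arcG psi) :
  coloured_MINI_orientation arcG (h \o psi).
Proof.
case: hMINI => -[arcH_adj _] h_col hloc; case: hG => arcG_adj adj_arcG.
have out_psi v u : u \in out_nbhd arcG v -> psi u \in out_nbhd arcH (psi v).
  by rewrite !inE; apply: hhom.
have in_psi v u : u \in in_nbhd arcG v -> psi u \in in_nbhd arcH (psi v).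
  by rewrite !inE; apply: hhom.
split=> [//|u v /adj_arcG uv|v].
  have : adj (psi u) (psi v).
    (* Whichever way the edge is oriented, its arc maps to an arc of [H], hence to an edge. *)
    have [/hhom/arcH_adj //|nuv] := boolP (arcG u v).
    by move: uv; rewrite (negbTE nuv) adj_sym => /hhom/arcH_adj.
  exact: h_col.
have [out_in out_inj in_eq] := hloc (psi v); split=> u w uv wv.
- by apply: out_in; [apply: out_psi | apply: in_psi].
(* Equal colours force [psi u = psi w] by injectivity of [h] around [psi v]; then [hinj] gives
   [u = w]. *)
- by move=> /out_inj eq_psi; apply: (hinj v) => //; apply: eq_psi; apply: out_psi.
- by apply: in_eq; apply: in_psi.
Qed.
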